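(* Let $X$ be an infinite dimensional real Banach space which admits an equivalent LUR norm. Then there exists an equivalent norm on $X$ which is LUR and is not URED. Moreover, the class of all equivalent norms on $X$ which are LUR and not URED is dense.
   Context: All Banach spaces are real. For a norm $\|\cdot\|$ on $X$, write $B_{\|\cdot\|}=\{x\in X:\|x\|\le 1\}$ and $S_{\|\cdot\|}=\{x\in X:\|x\|=1\}$. An equivalent norm $\|\cdot\|$ on $X$ is locally uniformly rotund (LUR) at $x\in S_{\|\cdot\|}$ if for every sequence $(y_n)_{n\in\mathbb N}$ in $B_{\|\cdot\|}$ with $\left\|\frac{x+y_n}{2}\right\|\to 1$ one has $\|x-y_n\|\to 0$. The norm is LUR if it is LUR at every $x\in S_{\|\cdot\|}$. An equivalent norm $\|\cdot\|$ on $X$ is uniformly rotund in every direction (URED) if for every $v\in S_{\|\cdot\|}$ and every pair of sequences $(x_n)_{n\in\mathbb N}$, $(y_n)_{n\in\mathbb N}$ in $B_{\|\cdot\|}$ such that $y_n-x_n=\lambda_n v$ for some $\lambda_n\in\mathbb R$ (for every $n$) and $\left\|\frac{x_n+y_n}{2}\right\|\to 1$, one has $\lambda_n\to 0$. A class $\mathcal S$ of equivalent norms on $X$ is dense if for every equivalent norm $\|\cdot\|$ on $X$ and every $\varepsilon>0$ there exists a norm $N\in\mathcal S$ such that $N(x)\le\|x\|\le(1+\varepsilon)N(x)$ for all $x\in X$. *)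

(* Defs.v *)
From HB Require Import structures.
From mathcomp Require Import all_boot all_order all_algebra.
From mathcomp Require Import all_classical all_reals all_analysis.

Set Implicit Arguments.
Unset Strict Implicit.
Unset Printing Implicit Defensive.

Import Order.TTheory GRing.Theory Num.Theory.
Import numFieldNormedType.Exports.

Local Open Scope classical_set_scope.
Local Open Scope ring_scope.

Definition infinite_dimensional (R : realType) (X : lmodType R) : Prop :=
  ~ exists (n : nat) (e : 'I_n -> X),
      forall x : X, exists c : 'I_n -> R, x = \sum_(i < n) c i *: e i.

Section Norms.
Context {R : realType} {X : normedModType R}.
Implicit Types (N : X -> R) (S : set (X -> R)).

(* Norms other than the canonical one `|x| are plain functions X -> R, so that
   several of them can live on the same space X. *)
Record is_norm N : Prop := {
  is_norm_eq0 : forall x, N x = 0 -> x = 0;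
  is_normZ : forall (a : R) x, N (a *: x) = `|a| * N x;
  is_norm_triangle : forall x y, N (x + y) <= N x + N y }.

Definition equivalent_norm N : Prop :=
  is_norm N /\
  exists a b : R, [/\ 0 < a, 0 < b &
    forall x : X, a * `|x| <= N x /\ N x <= b * `|x|].

Definition unit_ball N : set X := [set x | N x <= 1].

Definition unit_sphere N : set X := [set x | N x = 1].

Definition LUR_at N (x : X) : Prop :=
  forall y : nat -> X, (forall n, unit_ball N (y n)) ->
    N (2^-1 *: (x + y n)) @[n --> \oo] --> (1 : R) ->
    N (x - y n) @[n --> \oo] --> (0 : R).

Definition LUR N : Prop := forall x, unit_sphere N x -> LUR_at N x.

Definition URED N : Prop :=
  forall v, unit_sphere N v ->
  forall (x y : nat -> X) (lambda : nat -> R),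
    (forall n, unit_ball N (x n)) ->
    (forall n, unit_ball N (y n)) ->
    (forall n, y n - x n = lambda n *: v) ->
    N (2^-1 *: (x n + y n)) @[n --> \oo] --> (1 : R) ->
    lambda n @[n --> \oo] --> (0 : R).

(* Density of a class of equivalent norms is not density for a topology on
   X -> R: approximants lie below the norm, up to a factor 1 + eps. *)
Definition dense_norms S : Prop :=
  forall N, equivalent_norm N -> forall eps : R, 0 < eps ->
  exists2 M, S M & forall x, M x <= N x /\ N x <= (1 + eps) * M x.

End Norms.

(* Main.v *)
Require Import Defs.
From HB Require Import structures.
From mathcomp Require Import all_boot all_order all_algebra.
From mathcomp Require Import all_classical all_reals all_analysis.
From mathcomp Require Import ring lra.
Import Order.TTheory GRing.Theory Num.Theory.
Import numFieldNormedType.Exports.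
Local Open Scope classical_set_scope.
Local Open Scope ring_scope.

(** Let [N] be the norm to be approximated from below and [L] a LUR norm, scaled
    so that [L <= N].  Fix [v], and choose by Riesz's lemma [N]-unit vectors
    [y n] at distance almost 1 from [F n], the span of [v] and the earlier
    [y i]; this is where infinite dimension is used.  Write [p n] for the
    [N]-distance to [F n] and [s] for the [N]-distance to the union of the
    [F n], so that [p n x] decreases to [s x] at every [x].  With constants
    [B < A < 1], a small [T > 0], and [e n] tending to 0, the new norm is the
    square root of the supremum [f] of

      [B * N^2 + T * L^2],  [A * s^2 + T * L^2],  and, for all [n],
      [A * ((1 - e n) * p n ^2 + e n / 4 * L^2)].

    The first term gives [B * N^2 <= f], and all of them are at most [N^2].

    Not URED: [p n] vanishes on the line of [v], and so does [s] on the [y n]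
    and [v].  Hence [f (y n + r *: v) <= A] for all [n] and all small [r],
    whereas the [n]-th term of the family at [y n] tends to [A]: the points
    [y n] are midpoints of almost flat segments of fixed length and direction
    [v] ([LUR_perturbation], [not_URED]).

    LUR: each term is a squared seminorm plus a positive multiple of [L^2],
    hence inherits rotundity from [L], though the multiple degenerates with
    [n].  At a given [x != 0] the [n]-th term tends to [A * s x ^ 2], which the
    second term exceeds by [T * L x ^ 2].  So the terms that almost attain the
    supremum near [x] are among finitely many, and these are uniformly good
    at [x] ([sup_qLUR]).  Rotundity is handled in the quadratic form [qLUR],
    where it is stable under such sums; the equivalence with the sequential
    definition is in [LUR_qLUR] and [qLUR_LUR].

    The distance seminorms [p n] do the work that a weak-star null sequence of
    norm-one functionals would do, without its existence theorem; the seminorm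
    [s] absorbs what such a sequence would lose in the limit. *)

(** * Seminorms and distances to subspaces *)

Section Seminorm.
Context {R : realType} {X : lmodType R}.
Implicit Types (p f : X -> R) (F : set X) (l : seq X).

Record seminorm p : Prop := {
  seminormZ : forall (a : R) x, p (a *: x) = `|a| * p x;
  seminormD : forall x y, p (x + y) <= p x + p y }.

Record subspace F : Prop := {
  subspace0 : F 0;
  subspaceD : forall x y, F x -> F y -> F (x + y);
  subspaceZ : forall (a : R) x, F x -> F (a *: x) }.

Lemma seminorm0 p : seminorm p -> p 0 = 0.
Proof. by move=> hp; rewrite -(scale0r 0) (seminormZ _ hp) normr0 mul0r. Qed.

Lemma seminormN p x : seminorm p -> p (- x) = p x.
Proof.
by move=> hp; rewrite -scaleN1r (seminormZ _ hp) normrN normr1 mul1r.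
Qed.

Lemma seminorm_ge0 p x : seminorm p -> 0 <= p x.
Proof.
move=> hp; have := seminormD _ hp x (- x).
by rewrite subrr seminorm0// seminormN//; lra.
Qed.

(** The seminorm of the quotient by [F], seen on [X]. *)
Definition dist p F x : R := inf [set p (x - w) | w in F].

Section Dist.
Variables (p : X -> R) (F : set X).
Hypotheses (hp : seminorm p) (hF : subspace F).

Lemma dist_le x w : F w -> dist p F x <= p (x - w).
Proof.
move=> Fw; apply: ge_inf; last by exists w.
by exists 0 => _ [u _ <-]; exact: seminorm_ge0.
Qed.

Lemma dist_ge x a : (forall w, F w -> a <= p (x - w)) -> a <= dist p F x.
Proof.
move=> h; apply: lb_le_inf; first by exists (p (x - 0)), 0 => //; exact: subspace0.
by move=> _ [u Fu <-]; exact: h.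
Qed.

Lemma dist_near x e : 0 < e -> exists2 w, F w & p (x - w) < dist p F x + e.
Proof.
move=> e0; have [|_ [w Fw <-] h] := @inf_adherent R [set p (x - w) | w in F] e e0.
  split; first by exists (p (x - 0)), 0 => //; exact: subspace0.
  by exists 0 => _ [u _ <-]; exact: seminorm_ge0.
by exists w.
Qed.

Lemma dist_le_seminorm x : dist p F x <= p x.
Proof. by rewrite -[X in p X]subr0; apply: dist_le; exact: subspace0. Qed.

Lemma dist_mem x : F x -> dist p F x = 0.
Proof.
move=> Fx; apply/eqP; rewrite eq_le; apply/andP; split.
  by rewrite -(seminorm0 _ hp) -(subrr x); exact: dist_le.
by apply: dist_ge => w _; exact: seminorm_ge0.
Qed.

Lemma dist_seminorm : seminorm (dist p F).
Proof.
have scale (a : R) x : `|a| * dist p F x <= dist p F (a *: x).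
  have [->|a0] := eqVneq a 0.
    rewrite normr0 mul0r; apply: dist_ge => w _; exact: seminorm_ge0.
  apply: dist_ge => w Fw.
  have -> : a *: x - w = a *: (x - a^-1 *: w).
    by rewrite scalerBr scalerA divff// scale1r.
  rewrite (seminormZ _ hp) ler_wpM2l//; apply: dist_le.
  exact: subspaceZ.
split=> [a x|x y].
  apply/eqP; rewrite eq_le scale andbT.
  have [->|a0] := eqVneq a 0.
    by rewrite normr0 mul0r scale0r dist_mem//; exact: subspace0.
  have := scale a^-1 (a *: x).
  rewrite scalerA mulVf// scale1r normfV mulrC ler_pdivrMr ?normr_gt0//.
  by rewrite mulrC.
apply/ler_addgt0Pr => e e0.
have e20 : 0 < e / 2 by rewrite divr_gt0.
have [u Fu hu] := dist_near x _ e20.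
have [w Fw hw] := dist_near y _ e20.
have := dist_le (x + y) _ (subspaceD _ hF _ _ Fu Fw).
have -> : x + y - (u + w) = (x - u) + (y - w) by rewrite opprD addrACA.
have := seminormD _ hp (x - u) (y - w).
by move: hu hw; lra.
Qed.

End Dist.

Lemma dist_subset p F F' x : seminorm p -> subspace F -> F `<=` F' ->
  dist p F' x <= dist p F x.
Proof.
by move=> hp hF FF'; apply: dist_ge => // w Fw; apply: dist_le => //; exact: FF'.
Qed.

(** Recursive in the generators, so that finite-dimensional arguments proceed
    by adding one line at a time. *)
Fixpoint span l : set X :=
  if l is v :: l' then [set x | exists t : R, span l' (x - t *: v)] else [set 0].

Lemma span_subspace l : subspace (span l).
Proof.
elim: l => [|v l [h0 hD hZ]] /=.
  by split=> [|x y -> ->|a x ->]; rewrite ?addr0 ?scaler0.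
split=> [|x y [s hs] [t ht]|a x [s hs]].
- by exists 0; rewrite scale0r subr0.
- by exists (s + t); rewrite scalerDl opprD addrACA; exact: hD.
- by exists (a * s); rewrite -scalerA -scalerBr; exact: hZ.
Qed.

Lemma span_cons v l : span l `<=` span (v :: l).
Proof. by move=> x lx; exists 0; rewrite scale0r subr0. Qed.

Lemma span_head v l : span (v :: l) v.
Proof. by exists 1; rewrite scale1r subrr; exact: subspace0 (span_subspace l). Qed.

Lemma span_full_finite l : (forall x, span l x) ->
  exists (n : nat) (e : 'I_n -> X),
    forall x : X, exists c : 'I_n -> R, x = \sum_(i < n) c i *: e i.
Proof.
move=> lT; exists (size l), (fun i => nth 0 l i) => x.
elim: l x {lT}(lT x) => [x ->|v l IH x [t /IH[c hc]]].
  by exists (fun=> 0); rewrite big_ord0.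
exists (fun i => if unlift ord0 i is Some j then c j else t).
rewrite big_ord_recl unlift_none /= -(subrK (t *: v) x) hc addrC.
by congr (_ + _); apply: eq_bigr => i _; rewrite liftK.
Qed.

(** Finite-dimensional subspaces are closed.  When [v] has positive distance
    [d] to [span l], the intervals of centre [t] and radius
    [dist (x - t *: v) / d] meet pairwise, so some [t0] lies in all of them;
    it nearly minimises the distance of [x - t *: v] to [span l]. *)
Lemma dist_span_eq0 p l x : seminorm p -> (forall y, p y = 0 -> y = 0) ->
  dist p (span l) x = 0 -> span l x.
Proof.
move=> hp p0; elim: l x => [|v l IH] x h.
  apply: p0; apply/eqP; rewrite eq_le seminorm_ge0// andbT -h.
  by apply: dist_ge => //; [exact: (span_subspace [::])|move=> w ->; rewrite subr0].
have hl := span_subspace l.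
set d := dist p (span l) in IH.
have hd : seminorm d by exact: dist_seminorm.
have small e : 0 < e -> exists t, d (x - t *: v) < e.
  move=> e0; have [w [t tw]] := dist_near _ _ hp (span_subspace (v :: l)) x _ e0.
  rewrite h add0r => hw; exists t; apply: le_lt_trans hw.
  have := dist_le _ _ hp (x - t *: v) _ tw.
  by rewrite opprB subrKA.
have lip s t : d (x - s *: v) <= d (x - t *: v) + `|s - t| * d v.
  have := seminormD _ hd (x - t *: v) ((t - s) *: v).
  by rewrite (seminormZ _ hd) distrC scalerBl subrKA.
have [dv0|dv0] := eqVneq (d v) 0.
  exists 0; rewrite scale0r subr0; apply: IH; apply/eqP.
  rewrite eq_le seminorm_ge0// andbT; apply/ler_addgt0Pr => e e0.
  have [t ht] := small _ e0; have := lip 0 t.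
  by rewrite dv0 mulr0 scale0r subr0; lra.
have dv : 0 < d v by rewrite lt_neqAle eq_sym dv0 seminorm_ge0.
pose A := [set t - d (x - t *: v) / d v | t in [set: R]].
have up t s : t - d (x - t *: v) / d v <= s + d (x - s *: v) / d v.
  have : `|t - s| * d v <= d (x - s *: v) + d (x - t *: v).
    rewrite -(seminormZ _ hd).
    have -> : (t - s) *: v = (x - s *: v) - (x - t *: v).
      by rewrite scalerBl opprB [RHS]addrC subrKA.
    by rewrite -[d (x - t *: v)](seminormN _ _ hd); exact: seminormD.
  rewrite -ler_pdivlMr// mulrDl; have := ler_norm (t - s); lra.
have A0 : A !=set0 by exists (0 - d (x - 0 *: v) / d v), 0.
exists (sup A); apply: IH; apply/eqP.
rewrite eq_le seminorm_ge0// andbT; apply/ler_addgt0Pr => e e0.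
have e20 : 0 < e / 2 by rewrite divr_gt0.
have [t ht] := small _ e20.
have : `|sup A - t| <= d (x - t *: v) / d v.
  rewrite ler_distl; apply/andP; split.
    apply: ub_le_sup; last by exists t.
    by exists (t + d (x - t *: v) / d v) => _ [u _ <-]; exact: up.
  by apply: ge_sup => // _ [u _ <-]; exact: up.
by rewrite ler_pdivlMr//; have := lip (sup A) t; move: ht; lra.
Qed.

(** Riesz's lemma: since [span l] is closed, some [x] has positive distance to
    it, and [x] minus a nearly closest point of [span l] has almost the norm
    of its own distance. *)
Lemma riesz p l e : seminorm p -> (forall y, p y = 0 -> y = 0) ->
  ~ (forall x, span l x) -> 0 < e -> e < 1 ->
  exists y, p y = 1 /\ 1 - e <= dist p (span l) y.
Proof.
move=> hp p0 /existsNP[x nx] e0 e1.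
have hl := span_subspace l.
have hd := dist_seminorm _ _ hp hl.
have d0 : 0 < dist p (span l) x.
  rewrite lt_neqAle seminorm_ge0// andbT eq_sym.
  by apply/eqP => h; apply: nx; apply: dist_span_eq0 h.
set d := dist p (span l) x in d0.
have t0 : 0 < d * (e / (1 - e)) by rewrite mulr_gt0// divr_gt0//; lra.
have [w lw hw] := dist_near _ _ hp hl x _ t0.
have q0 : 0 < p (x - w) by apply: lt_le_trans d0 _; exact: dist_le.
exists ((p (x - w))^-1 *: (x - w)).
rewrite (seminormZ _ hp) (seminormZ _ hd) ger0_norm ?invr_ge0 ?(ltW q0)//.
split; first by rewrite mulVf// gt_eqF.
rewrite mulrC ler_pdivlMr//.
have dd : d <= dist p (span l) (x - w).
  have := seminormD _ hd (x - w) w.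
  by rewrite subrK (dist_mem _ _ hp hl _ lw) addr0.
apply: le_trans dd; rewrite -/d in hw.
have -> : d = (1 - e) * (d + d * (e / (1 - e))) by field; lra.
by rewrite ler_wpM2l//; [lra|exact: ltW].
Qed.

End Seminorm.

(** * Squared seminorms *)

Section Squares.
Context {R : realType} {X : lmodType R}.
Implicit Types (p f g : X -> R) (G : nat -> X -> R).

(** The squares of seminorms, characterised so that nonnegative combinations
    and suprema visibly preserve them: the last condition, taken for all [t],
    is equivalent to the triangle inequality for the square root. *)
Record sqseminorm f : Prop := {
  sqseminorm_ge0 : forall x, 0 <= f x;
  sqseminormZ : forall (a : R) x, f (a *: x) = a ^+ 2 * f x;
  sqseminormD : forall x y (t : R), 0 < t ->
    f (x + y) <= (1 + t) * f x + (1 + t^-1) * f y }.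

Lemma seminorm_sqr p : seminorm p -> sqseminorm (fun x => p x ^+ 2).
Proof.
move=> hp; split=> [x|a x|x y t t0]; first exact: sqr_ge0.
  by rewrite (seminormZ _ hp) exprMn real_normK ?num_real.
apply: (@le_trans _ _ ((p x + p y) ^+ 2)).
  by rewrite ler_sqr ?nnegrE ?addr_ge0 ?seminorm_ge0// seminormD.
rewrite -subr_ge0.
have -> : (1 + t) * p x ^+ 2 + (1 + t^-1) * p y ^+ 2 - (p x + p y) ^+ 2 =
  t * (p x - t^-1 * p y) ^+ 2 by field; lra.
by rewrite mulr_ge0 ?sqr_ge0// ltW.
Qed.

Lemma sqseminorm_comb f g (a b : R) : 0 <= a -> 0 <= b ->
  sqseminorm f -> sqseminorm g -> sqseminorm (fun x => a * f x + b * g x).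
Proof.
move=> a0 b0 hf hg; split=> [x|c x|x y t t0].
- by rewrite addr_ge0// mulr_ge0// sqseminorm_ge0.
- by rewrite (sqseminormZ _ hf) (sqseminormZ _ hg); ring.
- have /(ler_wpM2l a0) := sqseminormD _ hf x y t t0.
  have /(ler_wpM2l b0) := sqseminormD _ hg x y t t0.
  lra.
Qed.

Lemma sqrt_seminorm f : sqseminorm f -> seminorm (fun x => Num.sqrt (f x)).
Proof.
move=> hf; split=> [a x|x y].
  by rewrite (sqseminormZ _ hf) sqrtrM ?sqr_ge0// sqrtr_sqr.
set a := Num.sqrt (f x); set b := Num.sqrt (f y).
have fa : f x = a ^+ 2 by rewrite sqr_sqrtr ?sqseminorm_ge0.
have fb : f y = b ^+ 2 by rewrite sqr_sqrtr ?sqseminorm_ge0.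
have a0 : 0 <= a by exact: sqrtr_ge0.
have b0 : 0 <= b by exact: sqrtr_ge0.
apply/ler_addgt0Pr => e e0.
have c0 : 0 <= a + b + e by lra.
rewrite -(ler_sqr (sqrtr_ge0 _))// sqr_sqrtr ?sqseminorm_ge0//.
(* the optimal parameter is [b / a]; the shift by [e / 2] avoids zeros *)
pose u := a + e / 2; pose v := b + e / 2.
have u0 : 0 < u by rewrite /u; lra.
have v0 : 0 < v by rewrite /v; lra.
apply: le_trans (sqseminormD _ hf x y (v / u) _) _; first exact: divr_gt0.
have -> : (a + b + e) ^+ 2 = (1 + v / u) * u ^+ 2 + (1 + (v / u)^-1) * v ^+ 2.
  have -> : a + b + e = u + v by rewrite /u /v; lra.
  by field; rewrite !gt_eqF.
have q0 : 0 < v / u by rewrite divr_gt0.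
have q1 : 0 < (v / u)^-1 by rewrite invr_gt0.
have au : a ^+ 2 <= u ^+ 2 by rewrite ler_sqr ?nnegrE// /u; lra.
have bv : b ^+ 2 <= v ^+ 2 by rewrite ler_sqr ?nnegrE// /v; lra.
by rewrite fa fb lerD// ler_wpM2l// ltW// addr_gt0.
Qed.

Definition pointwise_sup G x : R := sup (range (G^~ x)).

Section Sup.
Variables (G : nat -> X -> R) (h : X -> R).
Hypothesis Gh : forall n x, G n x <= h x.

Lemma pointwise_sup_ge n x : G n x <= pointwise_sup G x.
Proof. by apply: ub_le_sup; [exists (h x) => _ [m _ <-]|exists n]. Qed.

Lemma pointwise_sup_le x a : (forall n, G n x <= a) -> pointwise_sup G x <= a.
Proof. by move=> Ga; apply: ge_sup => [|_ [m _ <-]//]; exists (G 0%N x), 0%N. Qed.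

Lemma pointwise_sup_near x e : 0 < e -> exists n, pointwise_sup G x - e < G n x.
Proof.
move=> e0; have [|_ [n _ <-] hn] := @sup_adherent R (range (G^~ x)) e e0.
  by split; [exists (G 0%N x), 0%N|exists (h x) => _ [m _ <-]].
by exists n.
Qed.

Lemma sqseminorm_sup : (forall n, sqseminorm (G n)) ->
  sqseminorm (pointwise_sup G).
Proof.
move=> hG; have S0 x : 0 <= pointwise_sup G x.
  by apply: le_trans (pointwise_sup_ge 0 x); exact: sqseminorm_ge0.
split=> // [a x|x y t t0].
  have scale (b : R) z : pointwise_sup G (b *: z) <= b ^+ 2 * pointwise_sup G z.
    apply: pointwise_sup_le => n; rewrite (sqseminormZ _ (hG n)) ler_wpM2l ?sqr_ge0//.
    exact: pointwise_sup_ge.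
  apply/eqP; rewrite eq_le scale /=; have [->|a0] := eqVneq a 0.
    by rewrite expr0n/= mul0r.
  have := scale a^-1 (a *: x).
  by rewrite scalerA mulVf// scale1r exprVn ler_pdivlMl// exprn_even_gt0.
apply: pointwise_sup_le => n; apply: le_trans (sqseminormD _ (hG n) x y t t0) _.
have := pointwise_sup_ge n x; have := pointwise_sup_ge n y.
have : 0 < t^-1 by rewrite invr_gt0.
by move=> ti hy hx; rewrite lerD// ler_wpM2l//; lra.
Qed.

End Sup.

(** The defect of the parallelogram inequality. *)
Definition defect f x y : R := 2 * f x + 2 * f y - f (x + y).

Lemma defect_ge0 f x y : sqseminorm f -> 0 <= defect f x y.
Proof. by move=> hf; have := sqseminormD _ hf x y 1 ltr01; rewrite /defect; lra. Qed.

Lemma defectZ f (a : R) x y : sqseminorm f ->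
  defect f (a *: x) (a *: y) = a ^+ 2 * defect f x y.
Proof. by move=> hf; rewrite /defect -(scalerDr a) !(sqseminormZ _ hf); ring. Qed.

Lemma defect_sqr p x y : seminorm p ->
  (p x - p y) ^+ 2 <= defect (fun z => p z ^+ 2) x y.
Proof.
move=> hp; have : p (x + y) ^+ 2 <= (p x + p y) ^+ 2.
  by rewrite ler_sqr ?nnegrE ?addr_ge0 ?seminorm_ge0// seminormD.
by rewrite /defect; lra.
Qed.

(** Local uniform rotundity of the square root of [f], in quadratic form: free
    of any normalisation, and with the defect linear in [f]. *)
Definition qLUR f : Prop := forall x (e : R), 0 < e ->
  exists2 d, 0 < d & forall y, defect f x y <= d -> f (x - y) <= e.

(** If the [G n] are locally uniformly rotund, but not uniformly in [n], so is
    their supremum [F], provided that at each [x] all but finitely many [G n x]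
    stay away from [F x]: when [defect F x y] is small, an index [n] that almost
    attains [F (x + y)] has [G n x] close to [F x], hence is one of finitely
    many. *)
Lemma sup_qLUR G h k (C : R) : (forall n x, G n x <= h x) ->
  (forall n, sqseminorm (G n)) -> qLUR k ->
  (forall n, exists2 t : R, 0 < t &
    forall x y, t * defect k x y <= defect (G n) x y) ->
  0 < C -> (forall x, pointwise_sup G x <= C * k x) ->
  (forall x, x != 0 -> exists2 c, c < pointwise_sup G x &
    exists m, forall n, (m <= n)%N -> G n x <= c) ->
  qLUR (pointwise_sup G).
Proof.
move=> Gh hG hk Gk C0 FC Fev; set F := pointwise_sup G.
have hF : sqseminorm F by exact: sqseminorm_sup Gh hG.
move=> x e e0; have [->|x0] := eqVneq x 0.
  exists e => // y; rewrite /defect !add0r -scaleN1r.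
  rewrite (sqseminormZ _ hF) -[X in F X](scale0r (0 : X)) (sqseminormZ _ hF).
  have := sqseminorm_ge0 _ hF y; lra.
have eC0 : 0 < e / C by rewrite divr_gt0.
have [d d0 hd] := hk x _ eC0.
have [c cF [m hm]] := Fev _ x0.
have [t t0 ht] : exists2 t : R, 0 < t &
    forall n y, (n < m)%N -> defect (G n) x y < t -> defect k x y <= d.
  elim: m {hm} => [|m [s s0 hs]]; first by exists 1.
  have [r r0 hr] := Gk m; exists (Num.min s (r * d)).
    by rewrite lt_min s0 mulr_gt0.
  move=> n y; rewrite ltnS leq_eqVlt lt_min => /orP[/eqP ->|nm] /andP[h1 h2].
    by have /le_lt_trans/(_ h2) := hr x y; rewrite ltr_pM2l// => /ltW.
  exact: hs nm h1.
pose d' := Num.min (t / 2) (F x - c) / 2.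
have d'0 : 0 < d' by rewrite divr_gt0// lt_min divr_gt0// subr_gt0.
have d't : d' * 2 <= t / 2 by rewrite /d' mulfVK ?ge_min ?lexx.
have d'c : d' * 2 <= F x - c by rewrite /d' mulfVK ?ge_min ?lexx ?orbT.
exists d' => // y hy.
have [n hn] := pointwise_sup_near _ _ Gh (x + y) _ d'0.
have := pointwise_sup_ge _ _ Gh n x; have := pointwise_sup_ge _ _ Gh n y.
rewrite -/F in hn * => Gy Gx; rewrite {1}/defect in hy.
have G0 := defect_ge0 _ x y (hG n).
apply: le_trans (FC _) _; rewrite mulrC -ler_pdivlMr//; apply: hd.
apply: (ht n); last by rewrite /defect; lra.
rewrite ltnNge; apply/negP => /hm hc.
by move: G0; rewrite /defect; lra.
Qed.

End Squares.

(** * Quadratic form of local uniform rotundity *)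

Section LURquadratic.
Context {R : realType} {X : normedModType R}.
Implicit Types (N : X -> R).

Lemma is_norm_seminorm N : is_norm N -> seminorm N.
Proof. by case. Qed.

Lemma is_norm_gt0 N x : is_norm N -> x != 0 -> 0 < N x.
Proof.
move=> hN x0; have hs := is_norm_seminorm _ hN.
rewrite lt_neqAle seminorm_ge0// andbT eq_sym.
by apply: contra x0 => /eqP/(is_norm_eq0 hN) ->.
Qed.

Lemma LUR_at_modulus {N x} {e : R} : is_norm N -> N x = 1 -> LUR_at N x ->
  0 < e ->
  exists2 d, 0 < d & forall y, N y <= 1 -> 1 - d <= N (2^-1 *: (x + y)) ->
    N (x - y) <= e.
Proof.
move=> hN Nx lur e0; apply: contrapT => h.
have hs := is_norm_seminorm _ hN.
have /choice[y hy] : forall n, exists y, [/\ N y <= 1,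
    1 - n.+1%:R^-1 <= N (2^-1 *: (x + y)) & e < N (x - y)].
  move=> n; apply/not_existsP => hn; apply: h; exists n.+1%:R^-1.
    by rewrite invr_gt0 ltr0n.
  by move=> y h1 h2; rewrite leNgt; apply/negP => h3; apply: (hn y).
have /lur : forall n, unit_ball N (y n) by move=> n; have [] := hy n.
have cv : N (2^-1 *: (x + y n)) @[n --> \oo] --> (1 : R).
  apply: (@squeeze_cvgr _ _ _ _ (fun n => 1 - n.+1%:R^-1) (fun=> 1)).
  - near=> n; have [h1 h2 _] := hy n; rewrite h2/= (seminormZ _ hs).
    rewrite ger0_norm ?invr_ge0//; have := seminormD _ hs x (y n); lra.
  - rewrite -[X in _ --> X]subr0; apply: cvgB; first exact: cvg_cst.
    exact: cvg_harmonic.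
  - exact: cvg_cst.
move=> /(_ cv) /cvgrPdist_le /(_ _ e0)[m _ /(_ m (leqnn m))] /=.
have [_ _] := hy m; rewrite sub0r normrN ger0_norm ?seminorm_ge0//.
by move=> /lt_le_trans/[apply]; rewrite ltxx.
Unshelve. all: by end_near. Qed.

(** By homogeneity one reduces to a unit vector [u].  A small quadratic defect
    at [u] and [z] bounds [N u - N z], so [z] is close to a point [z'] of the
    unit ball, and the midpoint of [u] and [z'] has norm almost 1. *)
Lemma LUR_qLUR N : is_norm N -> LUR N -> qLUR (fun x => N x ^+ 2).
Proof.
move=> hN lur x e e0; have hs := is_norm_seminorm _ hN.
have N0 z : 0 <= N z by exact: seminorm_ge0.
have [->|x0] := eqVneq x 0.
  exists e => // y; rewrite /defect !add0r seminormN// seminorm0// expr0n/=.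
  by have := sqr_ge0 (N y); lra.
have Nx := is_norm_gt0 _ _ hN x0.
(* the unit vector of direction [x] and the rescaled precision *)
pose r := N x; have r0 : 0 < r by [].
have [u Nu xu] : exists2 u, N u = 1 & x = r *: u.
  exists (r^-1 *: x); last by rewrite scalerA divff ?gt_eqF// scale1r.
  by rewrite (seminormZ _ hs) gtr0_norm ?invr_gt0// mulVf ?gt_eqF.
pose e' := Num.sqrt e / r.
have e'0 : 0 < e' by rewrite divr_gt0// sqrtr_gt0.
have e'20 : 0 < e' / 2 by rewrite divr_gt0.
have [d1 d10 hd1] := LUR_at_modulus hN Nu (lur u Nu) e'20.
pose d := Num.min d1 (Num.min (e' / 2) 1).
have d0 : 0 < d by rewrite !lt_min d10 e'20 ltr01.
have dd1 : d <= d1 by rewrite ge_min lexx.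
have de : d <= e' / 2 by rewrite !ge_min lexx orbT.
have d1' : d <= 1 by rewrite !ge_min lexx !orbT.
exists (r ^+ 2 * d ^+ 2); first by rewrite mulr_gt0// exprn_gt0.
move=> y hy; have [z yz] : exists z, y = r *: z.
  by exists (r^-1 *: y); rewrite scalerA divff ?gt_eqF// scale1r.
have : defect (fun x => N x ^+ 2) u z <= d ^+ 2.
  have hq := seminorm_sqr _ hs; rewrite -(ler_pM2l (exprn_gt0 2 r0)).
  by apply: le_trans hy; rewrite xu yz (defectZ _ _ _ _ hq).
move=> hz; have := le_trans (defect_sqr _ u z hs) hz.
rewrite Nu -(ler_sqrt _ (sqr_ge0 d)) !sqrtr_sqr (gtr0_norm d0) ler_distl.
move=> /andP[Nz1 Nz2].
have Nuz : 2 - d <= N (u + z).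
  rewrite -ler_sqr ?nnegrE//; last lra.
  move: hz; rewrite /defect Nu.
  have : (1 - d) ^+ 2 <= N z ^+ 2 by rewrite ler_sqr ?nnegrE//; lra.
  lra.
(* [z] is almost in the unit ball; [z'] is its retraction into it *)
have [z' Nz' zz'] : exists2 z', N z' <= 1 & N (z - z') <= d.
  have [z1|z1] := leP (N z) 1; first by exists z; rewrite ?subrr ?seminorm0// ltW.
  have z0 : 0 < N z by lra.
  exists ((N z)^-1 *: z).
    by rewrite (seminormZ _ hs) gtr0_norm ?invr_gt0// mulVf ?gt_eqF.
  rewrite -{1}[z]scale1r -scalerBl (seminormZ _ hs) ger0_norm.
    by rewrite mulrBl mul1r mulVf ?gt_eqF//; lra.
  by rewrite subr_ge0 invf_le1// ltW.
have : N (u - z') <= e' / 2.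
  apply: hd1 => //; rewrite (seminormZ _ hs) ger0_norm ?invr_ge0//.
  have := seminormD _ hs (u + z') (z - z').
  by rewrite [u + z' + _]addrAC addrA subrK; lra.
move=> uz'; have : N (u - z) <= e'.
  have := seminormD _ hs (u - z') (z' - z).
  by rewrite subrKA -(seminormN _ (z' - z))// opprB; lra.
rewrite xu yz -scalerBr (seminormZ _ hs) (gtr0_norm r0) => uz.
rewrite -(sqr_sqrtr (ltW e0)) ler_sqr ?nnegrE ?sqrtr_ge0//; last first.
  by rewrite mulr_ge0// ltW.
by move: uz; rewrite /e' ler_pdivlMr// mulrC.
Qed.

Lemma qLUR_LUR N : is_norm N -> qLUR (fun x => N x ^+ 2) -> LUR N.
Proof.
move=> hN lur x Nx y hy; have hs := is_norm_seminorm _ hN.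
move=> /cvgrPdist_le cv; apply/cvgrPdist_le => e e0.
have [d d0 hd] := lur x _ (exprn_gt0 2 e0).
have d80 : 0 < d / 8 by rewrite divr_gt0.
apply: filterS (cv _ d80) => n.
rewrite sub0r normrN (ger0_norm (seminorm_ge0 _ _ hs)).
rewrite (seminormZ _ hs) (ger0_norm (_ : 0 <= 2^-1)) ?invr_ge0//.
rewrite ler_distlC => /andP[h _].
rewrite -ler_sqr ?nnegrE ?seminorm_ge0 ?(ltW e0)//; apply: hd; rewrite /defect Nx.
have Ny : N (y n) ^+ 2 <= 1.
  by have := hy n; rewrite -[X in _ <= X](expr1n _ 2) ler_sqr ?nnegrE ?seminorm_ge0.
(* [4 * m ^+ 2 >= 4 - d] for the norm [m >= 1 - d / 8] of the midpoint *)
set m := N (x + y n) in h *.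
have : 0 <= (2 - m) ^+ 2 by exact: sqr_ge0.
lra.
Qed.

End LURquadratic.

(** * The perturbed norm *)

Section Construction.
Context {R : realType} {X : lmodType R}.
Implicit Types (p N : X -> R) (F : nat -> set X).

Lemma bigcup_subspace F : (forall n, subspace (F n)) ->
  (forall n, F n `<=` F n.+1) -> subspace (\bigcup_n F n).
Proof.
move=> hF Fmono; have Fle := homo_leq (@subset_refl X) (@subset_trans X) Fmono.
split=> [|x y [m _ Fx] [n _ Fy]|a x [n _ Fx]].
- by exists 0%N => //; exact: subspace0.
- exists (maxn m n) => //; apply: subspaceD => //.
    by apply: Fle Fx; exact: leq_maxl.
  by apply: Fle Fy; exact: leq_maxr.
- by exists n => //; exact: subspaceZ.
Qed.

Lemma dist_bigcup_near p F x (e : R) : seminorm p ->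
  (forall n, subspace (F n)) -> (forall n, F n `<=` F n.+1) -> 0 < e ->
  exists m, forall n, (m <= n)%N ->
    dist p (F n) x < dist p (\bigcup_n F n) x + e.
Proof.
move=> hp hF Fmono e0; have Fle := homo_leq (@subset_refl X) (@subset_trans X) Fmono.
have [w [m _ Fw] hw] := dist_near _ _ hp (bigcup_subspace _ hF Fmono) x _ e0.
exists m => n mn; apply: le_lt_trans hw.
by apply: dist_le => //; exact: Fle Fw.
Qed.

(** Infinite dimension enters here: no finite list spans, so Riesz's lemma can be
    applied to the span of [v] and of the vectors already chosen. *)
Lemma almost_orthogonal_sequence p v (e : nat -> R) : infinite_dimensional X ->
  seminorm p -> (forall y, p y = 0 -> y = 0) ->
  (forall n, 0 < e n) -> (forall n, e n < 1) ->
  exists (F : nat -> set X) (y : nat -> X),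
    [/\ forall n, subspace (F n), forall n, F n `<=` F n.+1, F 0%N v &
        forall n, [/\ F n.+1 (y n), p (y n) = 1 & 1 - e n <= dist p (F n) (y n)]].
Proof.
move=> Xinf hp p0 e0 e1.
have /choice[g hg] : forall a : nat * seq X, exists y,
    p y = 1 /\ 1 - e a.1 <= dist p (span a.2) y.
  move=> [n l]; apply: riesz => //= lT.
  by apply: Xinf; exact: span_full_finite lT.
pose l := fix l n := if n is m.+1 then g (m, l m) :: l m else [:: v].
exists (fun n => span (l n)), (fun n => g (n, l n)); split=> [n|n||n].
- exact: span_subspace.
- exact: span_cons.
- exact: span_head.
- by have [h1 h2] := hg (n, l n); split=> //; exact: span_head.
Qed.

(** The squared form [f] of the new norm, together with the data [v], [y], [A]
    and [t] that contradict uniform rotundity in the direction [v]; [k] is the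
    square of a LUR norm. *)
Lemma LUR_perturbation N (k : X -> R) (B C : R) : infinite_dimensional X ->
  seminorm N -> (forall x, N x = 0 -> x = 0) ->
  sqseminorm k -> qLUR k -> (forall x, k x <= N x ^+ 2) ->
  0 < C -> (forall x, N x ^+ 2 <= C * k x) -> 0 < B -> B < 1 ->
  exists f : X -> R,
    [/\ sqseminorm f, qLUR f, forall x, B * N x ^+ 2 <= f x <= N x ^+ 2 &
     exists (v : X) (y : nat -> X) (A t : R),
     [/\ v != 0, 0 < A, 0 < t,
       forall n s, `|s| <= t -> f (y n + s *: v) <= A &
       f (y n) @[n --> \oo] --> A]].
Proof.
move=> Xinf hN N0 hk kLUR kN C0 Nk B0 B1.
have [v Nv] : exists v, N v = 1.
  have nspan : ~ forall x : X, span [::] x.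
    by move=> h; apply: Xinf; exact: span_full_finite h.
  have h2 : 2^-1 < 1 :> R by lra.
  have h0 : 0 < 2^-1 :> R by rewrite invr_gt0.
  by have [v [Nv _]] := riesz _ _ _ hN N0 nspan h0 h2; exists v.
pose e n : R := n.+2%:R^-1.
have e0 n : 0 < e n by rewrite invr_gt0.
have e1 n : e n < 1 by rewrite invf_lt1// ltr1n.
have [F [y [hF Fmono F0v hy]]] :=
  almost_orthogonal_sequence N v e Xinf hN N0 e0 e1.
have Fle := homo_leq (@subset_refl X) (@subset_trans X) Fmono.
have hW := bigcup_subspace _ hF Fmono.
set W := \bigcup_n F n in hW.
have hp n := dist_seminorm _ _ hN (hF n).
have hs := dist_seminorm _ _ hN hW.
(* the gap [1 - B] leaves room for [B < B + T < A < 1]; the half-length [t] of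
   the flat segments is such that [(B + T) * (1 + t) ^+ 2 <= A] *)
have [T [T0 BT1]] : exists T, 0 < T /\ B + 3 * T = 1.
  by exists ((1 - B) / 3); split; lra.
have [A AT] : exists A, A = 1 - T by exists (1 - T).
have [t tT] : exists t, t = T / 3 by exists (T / 3).
have A0 : 0 < A by lra.
have BTA : B + 2 * T = A by lra.
have t0 : 0 < t by lra.
have t1 : t <= 1 by lra.
(* the [n]-th term of the family is [a n * q n ^+ 2 + c n * k]; the indices 0
   and 1 hold the two terms that do not depend on the sequence *)
pose q n := if n is m.+1 then if m is i.+1 then dist N (F i) else dist N W else N.
pose a n := if n is m.+1 then if m is i.+1 then A * (1 - e i) else A else B.
pose c n := if n is m.+1 then if m is i.+1 then A * e i / 4 else T else T.
pose G n x := a n * q n x ^+ 2 + c n * k x.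
have hq n : seminorm (q n) by case: n => [|[|n]]; rewrite /q.
have e1' n : 0 <= 1 - e n by rewrite subr_ge0 ltW.
have a0 n : 0 <= a n.
  by case: n => [|[|n]]; rewrite /a ?mulr_ge0//; exact: ltW.
have c0 n : 0 < c n by case: n => [|[|n]]; rewrite /c ?divr_gt0 ?mulr_gt0.
have ac1 n : a n + c n <= 1.
  case: n => [|[|n]]; rewrite /a /c; try lra.
  have := e0 n; have := mulr_gt0 A0 (e0 n); lra.
have k0 x : 0 <= k x by exact: sqseminorm_ge0.
have hG n : sqseminorm (G n).
  by apply: sqseminorm_comb => //; [exact: ltW|exact: seminorm_sqr].
have qN n x : q n x ^+ 2 <= N x ^+ 2.
  rewrite ler_sqr ?nnegrE ?seminorm_ge0//.
  by case: n => [|[|n]]; rewrite /q //; exact: dist_le_seminorm.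
have GN n x : G n x <= N x ^+ 2.
  have := ler_wpM2l (a0 n) (qN n x); have := ler_wpM2l (ltW (c0 n)) (kN x).
  have := ler_wpM2r (sqr_ge0 (N x)) (ac1 n); rewrite /G; lra.
exists (pointwise_sup G); split.
- exact: sqseminorm_sup GN hG.
- apply: (sup_qLUR G _ k C GN hG kLUR _ C0).
  + move=> n; exists (c n) => // x z.
    have := mulr_ge0 (a0 n) (defect_ge0 _ x z (seminorm_sqr _ (hq n))).
    by rewrite /defect /G; lra.
  + by move=> x; apply: le_trans (Nk x); exact: pointwise_sup_le.
  + move=> x x0.
    have kx : 0 < k x.
      have : 0 < N x ^+ 2.
        rewrite exprn_gt0// lt_neqAle seminorm_ge0// andbT eq_sym.
        by apply: contra x0 => /eqP/N0 ->.
      by move=> /lt_le_trans/(_ (Nk x)); rewrite pmulr_rgt0.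
    have Tk : 0 < T * k x by rewrite mulr_gt0.
    set s := dist N W x.
    have s0 : 0 <= s by exact: seminorm_ge0.
    exists (A * s ^+ 2 + T * k x / 2).
      apply: lt_le_trans (pointwise_sup_ge _ _ GN 1 x).
      by rewrite /G /a /c /q -/s; lra.
    (* [d] makes [(s + d) ^+ 2 <= s ^+ 2 + T * k x / 4] *)
    pose d := Num.min 1 (T * k x / 4 / (2 * s + 1)).
    have d0 : 0 < d by rewrite lt_min ltr01 divr_gt0 ?divr_gt0//; lra.
    have d1 : d <= 1 by rewrite ge_min lexx.
    have ds : d * (2 * s + 1) <= T * k x / 4.
      by rewrite -ler_pdivlMr ?ge_min ?lexx ?orbT//; lra.
    have [m1 hm1] := dist_bigcup_near _ _ x _ hN hF Fmono d0.
    have [m2 _ hm2] := near_infty_natSinv_lt (PosNum T0).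
    exists (maxn m1 m2).+2 => -[|[|n]]//; rewrite !ltnS geq_max => /andP[/hm1 h1 h2].
    have eT : e n < T.
      by apply: lt_trans (hm2 _ h2); rewrite ltf_pV2 ?posrE ?ltr0n// ltr_nat.
    rewrite /G /a /c /q; set p := dist N (F n) x in h1 *.
    have p0 : 0 <= p by exact: seminorm_ge0.
    have p2 : p ^+ 2 <= s ^+ 2 + T * k x / 4.
      apply: (@le_trans _ _ ((s + d) ^+ 2)).
        by rewrite ler_sqr ?nnegrE//; rewrite -/W -/s in h1; lra.
      have : d * d <= d by rewrite ler_piMl// ltW.
      move: ds; lra.
    have A1 : A <= 1 by lra.
    have h3 := ler_wpM2l (ltW A0) p2.
    have h4 : A * (T * k x) <= T * k x by rewrite ler_piMl// ltW.
    have h5 : A * e n * p ^+ 2 >= 0 by rewrite !mulr_ge0// ?sqr_ge0// ltW.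
    have h6 : A * (e n * k x) <= T * k x.
      apply: (@le_trans _ _ (e n * k x)); last by rewrite ler_wpM2r// ltW.
      by rewrite ler_piMl// mulr_ge0// ltW.
    lra.
- move=> x; apply/andP; split; last exact: pointwise_sup_le.
  apply: le_trans (pointwise_sup_ge _ _ GN 0 x); rewrite /G /a /c /q.
  by have := mulr_ge0 (ltW T0) (k0 x); lra.
- have Fv n : F n v by apply: Fle F0v.
  have Wy n : W (y n) by exists n.+1 => //; have [] := hy n.
  have up n s : `|s| <= t -> pointwise_sup G (y n + s *: v) <= A.
    move=> st; set x := y n + s *: v.
    have Nx : N x <= 1 + t.
      have [_ Ny _] := hy n; apply: le_trans (seminormD _ hN _ _) _.
      by rewrite (seminormZ _ hN) Ny Nv mulr1 lerD2l.
    have Nx2 : N x ^+ 2 <= 1 + T.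
      apply: (@le_trans _ _ ((1 + t) ^+ 2)).
        by rewrite ler_sqr ?nnegrE ?(seminorm_ge0 _ _ hN)//; lra.
      have : t * t <= t by rewrite ler_piMl// ltW.
      lra.
    have kx : k x <= 1 + T by apply: le_trans (kN x) _.
    (* the terms 0 and 1 are at most [B + T] times [1 + T] at [x] *)
    have BT2 : (B + T) * (1 + T) <= A.
      have : (B + T) * T <= T by rewrite ler_piMl//; [exact: ltW|lra].
      lra.
    apply: pointwise_sup_le => -[|[|m]]; rewrite /G /a /c /q.
    + have := ler_wpM2l (ltW B0) Nx2; have := ler_wpM2l (ltW T0) kx; lra.
    + have -> : dist N W x = 0.
        apply: dist_mem => //; apply: (subspaceD _ hW) => //.
        by apply: (subspaceZ _ hW); exists 0%N.
      rewrite expr0n/= mulr0 add0r; apply: le_trans BT2.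
      apply: (@le_trans _ _ (T * (1 + T))); first by rewrite ler_wpM2l// ltW.
      by rewrite ler_wpM2r//; lra.
    + have px : dist N (F m) x <= 1.
        apply: le_trans (seminormD _ (hp m) _ _) _.
        rewrite (seminormZ _ (hp m)) (dist_mem _ _ hN (hF m) _ (Fv m)) mulr0 addr0.
        by have [_ <- _] := hy n; exact: dist_le_seminorm.
      have p2 : dist N (F m) x ^+ 2 <= 1.
        by rewrite -[leRHS](expr1n _ 2) ler_sqr ?nnegrE ?seminorm_ge0.
      have k4 : k x <= 4 by apply: le_trans kx _; lra.
      have h1 := ler_wpM2l (mulr_ge0 (ltW A0) (e1' m)) p2.
      have h2 := ler_wpM2l (mulr_ge0 (ltW A0) (ltW (e0 m))) k4.
      lra.
  exists v, y, A, t; split=> //.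
    by apply/eqP => v0; move: Nv; rewrite v0 seminorm0// => /esym/eqP; rewrite oner_eq0.
  apply: (@squeeze_cvgr _ _ _ _ (fun n => A - (3 * A) * n.+1%:R^-1) (fun=> A)).
  + near=> n; apply/andP; split; last first.
      by have := up n 0; rewrite normr0 scale0r addr0; apply; exact: ltW.
    apply: le_trans (pointwise_sup_ge _ _ GN n.+2 (y n)); rewrite /G /a /c /q.
    have [_ _ pn] := hy n.
    have p2 : (1 - e n) ^+ 2 <= dist N (F n) (y n) ^+ 2.
      by rewrite ler_sqr ?nnegrE ?(seminorm_ge0 _ _ (hp n)).
    have := ler_wpM2l (mulr_ge0 (ltW A0) (e1' n)) p2.
    have : 0 <= A * e n / 4 * k (y n) by rewrite !mulr_ge0// ltW.
    have : A * e n <= A * n.+1%:R^-1.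
      by rewrite ler_pM2l// lef_pV2 ?posrE ?ltr0n// ler_nat.
    have : 0 <= A * (e n ^+ 2 * (3 - e n)).
      apply: mulr_ge0; first exact: ltW.
      by rewrite mulr_ge0 ?sqr_ge0//; have := e1 n; lra.
    move: (n.+1%:R^-1 : R) => i; lra.
  + rewrite -[X in _ --> X]subr0 -[X in _ --> _ - X](mulr0 (3 * A)).
    apply: cvgB; first exact: cvg_cst.
    by apply: cvgMr; exact: cvg_harmonic.
  + exact: cvg_cst.
Unshelve. all: by end_near. Qed.

End Construction.

(** * Density of the LUR norms that are not URED *)

Section Conclusion.
Context {R : realType} {X : normedModType R}.
Implicit Types (N L M : X -> R).

(** The segments [y n + s *: v], [`|s| <= t], scaled by [r^-1], lie in the unit
    ball, have constant length, and their midpoints tend to the sphere. *)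
Lemma not_URED M v (y : nat -> X) (r t : R) : is_norm M -> v != 0 ->
  0 < r -> 0 < t -> (forall n s, `|s| <= t -> M (y n + s *: v) <= r) ->
  M (y n) @[n --> \oo] --> r -> ~ URED M.
Proof.
move=> hM v0 r0 t0 Mr cv ured; have hs := is_norm_seminorm _ hM.
have Mv := is_norm_gt0 _ _ hM v0.
have ri0 : 0 < r^-1 by rewrite invr_gt0.
pose u s n : X := r^-1 *: (y n + s *: v).
have u1 s : `|s| <= t -> forall n, unit_ball M (u s n).
  move=> st n; rewrite /unit_ball /= (seminormZ _ hs) gtr0_norm//.
  by rewrite mulrC ler_pdivrMr// mul1r Mr.
pose lam := r^-1 * (2 * t) * M v.
have lam0 : 0 < lam by rewrite !mulr_gt0.
suff /cvgrPdist_le /(_ _ (divr_gt0 lam0 (ltr0n R 2)))[m _ /(_ m (leqnn m))] /= :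
    lam @[_ --> \oo] --> (0 : R).
  by rewrite sub0r normrN gtr0_norm//; lra.
apply: (ured ((M v)^-1 *: v) _ (u (- t)) (u t)).
- by rewrite /unit_sphere /= (seminormZ _ hs) gtr0_norm ?invr_gt0// mulVf ?gt_eqF.
- by apply: u1; rewrite normrN gtr0_norm.
- by apply: u1; rewrite gtr0_norm.
- move=> n; rewrite /u -scalerBr opprD addrACA subrr add0r scaleNr opprK.
  by rewrite -scalerDl scalerA scalerA /lam mulfK ?gt_eqF//; congr (_ *: _); ring.
- have -> : (fun n => M (2^-1 *: (u (- t) n + u t n))) = (fun n => r^-1 * M (y n)).
    apply/funext => n; rewrite /u -scalerDr addrACA scaleNr addNr addr0.
    have -> : y n + y n = (2 : R) *: y n by rewrite scaler_nat mulr2n.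
    rewrite !scalerA (seminormZ _ hs) gtr0_norm ?mulr_gt0 ?invr_gt0//.
    by congr (_ * _); field; rewrite gt_eqF.
  by rewrite -[X in _ --> X](@mulVf _ r) ?gt_eqF//; exact: cvgMr.
Qed.

Lemma LUR_not_URED_dense L : infinite_dimensional X ->
  equivalent_norm L -> LUR L ->
  dense_norms [set N : X -> R | [/\ equivalent_norm N, LUR N & ~ URED N]].
Proof.
move=> Xinf [hL [aL [bL [aL0 bL0 Lbd]]]] lur N [hN [a [b [a0 b0 Nbd]]]] eps eps0.
have hLs := is_norm_seminorm _ hL; have hNs := is_norm_seminorm _ hN.
have N0 x : 0 <= N x by exact: seminorm_ge0.
have L0 x : 0 <= L x by exact: seminorm_ge0.
have [c c0 cL] : exists2 c, 0 < c & forall x, c * L x <= N x.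
  exists (a / bL) => [|x]; first exact: divr_gt0.
  have [_ h] := Lbd x; have [h' _] := Nbd x; apply: le_trans h'.
  by rewrite mulrAC ler_pdivrMr// -mulrA ler_wpM2l ?(ltW a0)// mulrC.
have [d d0 dL] : exists2 d, 0 < d & forall x, N x <= d * L x.
  exists (b / aL) => [|x]; first exact: divr_gt0.
  have [h _] := Lbd x; have [_ h'] := Nbd x; apply: le_trans h' _.
  by rewrite mulrAC ler_pdivlMr// -mulrA ler_wpM2l ?(ltW b0)// mulrC.
pose k x := (c * L x) ^+ 2.
have hcL : seminorm (fun x => c * L x).
  split=> [s x|x y]; first by rewrite (seminormZ _ hLs); ring.
  by rewrite -mulrDr ler_pM2l// seminormD.
have hk : sqseminorm k by exact: seminorm_sqr hcL.
have kLUR : qLUR k.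
  move=> x e e0; have c20 : 0 < c ^+ 2 by rewrite exprn_gt0.
  have [s s0 hs] := LUR_qLUR _ hL lur x _ (divr_gt0 e0 c20).
  exists (c ^+ 2 * s); first exact: mulr_gt0.
  move=> y hy; have : defect (fun x => L x ^+ 2) x y <= s.
    rewrite -(ler_pM2l c20); apply: le_trans hy.
    by rewrite /defect /k !exprMn; lra.
  by move=> /hs; rewrite ler_pdivlMr// mulrC -exprMn.
have kN x : k x <= N x ^+ 2 by rewrite ler_sqr ?nnegrE// mulr_ge0// ltW.
pose C := (d / c) ^+ 2; have C0 : 0 < C by rewrite exprn_gt0// divr_gt0.
have NC x : N x ^+ 2 <= C * k x.
  have -> : C * k x = (d * L x) ^+ 2 by rewrite /C /k; field; rewrite gt_eqF.
  by rewrite ler_sqr ?nnegrE// mulr_ge0// ltW.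
(* [B * N ^+ 2 <= M ^+ 2] then reads [N <= (1 + eps) * M] *)
pose B := ((1 + eps) ^+ 2)^-1.
have eps1 : 0 < 1 + eps by lra.
have B0 : 0 < B by rewrite invr_gt0 exprn_gt0.
have B1 : B < 1 by rewrite invf_lt1 ?exprn_gt0// exprn_egt1//; lra.
have [f [hf fLUR fN [v [y [A [t [v0 A0 t0 fA cv]]]]]]] :=
  LUR_perturbation N k B C Xinf hNs (is_norm_eq0 hN) hk kLUR kN C0 NC B0 B1.
have f0 x : 0 <= f x by exact: sqseminorm_ge0.
pose M x := Num.sqrt (f x).
have hMs : seminorm M by exact: sqrt_seminorm.
have MN x : M x <= N x.
  by have /andP[_] := fN x; rewrite -(ler_sqrt _ (sqr_ge0 _)) sqrtr_sqr ger0_norm.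
have NM x : N x <= (1 + eps) * M x.
  rewrite -ler_sqr ?nnegrE ?mulr_ge0 ?sqrtr_ge0 ?(ltW eps1)// exprMn sqr_sqrtr//.
  have /andP[h _] := fN x; move: h; rewrite /B mulrC ler_pdivrMr ?exprn_gt0//.
  by rewrite mulrC.
have hM : is_norm M.
  split; [|by case: hMs|by case: hMs].
  move=> x Mx; apply: (is_norm_eq0 hN); apply/eqP.
  by rewrite eq_le N0 andbT; have := NM x; rewrite Mx mulr0.
exists M; last by [].
split.
- split=> //; exists (a / (1 + eps)), b; split=> //; first exact: divr_gt0.
  move=> x; have [h1 h2] := Nbd x; split; last exact: le_trans (MN x) h2.
  by rewrite mulrAC ler_pdivrMr// mulrC [leRHS]mulrC (le_trans _ (NM x))// mulrC.
- apply: qLUR_LUR => //; congr (qLUR _): fLUR.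
  by apply/funext => x; rewrite sqr_sqrtr.
- apply: (not_URED M v y (Num.sqrt A) t) => //; first by rewrite sqrtr_gt0.
    by move=> n s st; rewrite ler_sqrt ?(ltW A0)//; exact: fA.
  by apply: (cvg_comp _ _ cv); exact: sqrt_continuous.
Qed.

End Conclusion.

Theorem theorem1 (R : realType) (X : completeNormedModType R)
    (Xinf : infinite_dimensional X)
    (XLUR : exists N : X -> R, equivalent_norm N /\ LUR N) :
  (exists N : X -> R, [/\ equivalent_norm N, LUR N & ~ URED N]) /\
  dense_norms [set N : X -> R | [/\ equivalent_norm N, LUR N & ~ URED N]].
Proof.
have [L [hL lur]] := XLUR.
have dense := LUR_not_URED_dense _ Xinf hL lur.
by split=> //; have [N hN _] := dense _ hL _ ltr01; exists N.
Qed.
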